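(* Let $(A,B,\alpha)$ be a generalized crossed module. Then there is a natural equivalence between the category $\mathsf{Cov}_{\mathsf{GXMod}}(A,B,\alpha)$ of covering generalized crossed modules of $(A,B,\alpha)$ and the category $\mathsf{LGXM}/(A,B,\alpha)$ of lifting generalized crossed modules of $(A,B,\alpha)$.
   Context: Groups are written additively (not necessarily abelian). All actions of a group on a group are left actions by group automorphisms. A group with action is a group $G$ together with an action of $G$ on itself, written ${}^{g}{g_1}$ (not necessarily conjugation). A morphism of groups with action $f\colon G\to H$ is a group homomorphism with $f({}^{g}{g_1})={}^{f(g)}{f(g_1)}$ for all $g,g_1\in G$. A generalized crossed module $(A,B,\alpha)$ consists of two groups with action $A,B$, a group homomorphism $\alpha\colon A\to B$ and an action $b\cdot a$ of the group $B$ on the group $A$ such that (i) $\alpha(b\cdot a)={}^{b}{\alpha(a)}$ and (ii) $\alpha(a)\cdot a_1={}^{a}{a_1}$ for all $a,a_1\in A$, $b\in B$. A morphism $\langle f,g\rangle\colon (A,B,\alpha)\to(A',B',\alpha')$ of generalized crossed modules is a pair of group homomorphisms $f\colon A\to A'$, $g\colon B\to B'$ with $g\alpha=\alpha' f$ and $f(b\cdot a)=g(b)\cdot f(a)$ for all $a\in A$, $b\in B$; composition is componentwise. A covering of $(A,B,\alpha)$ is a generalized crossed module $(\widetilde A,\widetilde B,\widetilde\alpha)$ together with a morphism $\langle f,g\rangle\colon(\widetilde A,\widetilde B,\widetilde\alpha)\to(A,B,\alpha)$ such that $f$ is an isomorphism (a covering morphism). A morphism from the covering $\langle\widetilde f,\widetilde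 g\rangle\colon(\widetilde A,\widetilde B,\widetilde\alpha)\to(A,B,\alpha)$ to the covering $\langle f',g'\rangle\colon(A',B',\alpha')\to(A,B,\alpha)$ is a morphism $\langle f,g\rangle\colon(\widetilde A,\widetilde B,\widetilde\alpha)\to(A',B',\alpha')$ of generalized crossed modules with $\langle f',g'\rangle\circ\langle f,g\rangle=\langle\widetilde f,\widetilde g\rangle$. These form $\mathsf{Cov}_{\mathsf{GXMod}}(A,B,\alpha)$. A lifting of $(A,B,\alpha)$ over $\omega$ consists of a group with action $X$, a group homomorphism $\omega\colon X\to B$ and a group homomorphism $\varphi\colon A\to X$ such that $\omega\varphi=\alpha$ and $(A,X,\varphi)$ is a generalized crossed module with respect to the action of $X$ on $A$ given by $x\cdot a=\omega(x)\cdot a$. A morphism from the lifting $(A,X,\varphi)$ over $\omega\colon X\to B$ to the lifting $(A,X',\varphi')$ over $\omega'\colon X'\to B$ is a morphism $f\colon X\to X'$ of groups with action such that $\omega' f=\omega$. These form $\mathsf{LGXM}/(A,B,\alpha)$.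
   Formalization: Morphisms of coverings ⟨f,g⟩ are also required to have g preserve the action of the base group on itself, and morphisms of liftings f are also required to satisfy fφ = φ'; without these the claim fails, over (0,0,0) and (Z,0,0) respectively. *)

(* Defs.v *)
From HB Require Import structures.
From mathcomp Require Import all_boot.
From mathcomp Require Import boolp.

Set Implicit Arguments.
Unset Strict Implicit.
Unset Printing Implicit Defensive.

Local Open Scope group_scope.

(* Groups are written multiplicatively, after [groupType], although they are
   usually written additively in this setting. *)

Definition is_group_action (G H : groupType) (act : G -> H -> H) : Prop :=
  [/\ forall x, act 1 x = x,
      forall g h x, act (g * h) x = act g (act h x)
    & forall g, monoid_morphism (act g)].

Record actGroup := ActGroup {
  ag_group :> groupType;
  self_act : ag_group -> ag_group -> ag_group;
  self_actP : is_group_action self_act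
}.
Arguments self_act {a} _ _.

Definition preserves_self_act (G H : actGroup) (f : G -> H) : Prop :=
  forall g x, f (self_act g x) = self_act (f g) (f x).

Definition is_actGroup_hom (G H : actGroup) (f : G -> H) : Prop :=
  monoid_morphism f /\ preserves_self_act f.

Definition is_gxmod (A B : actGroup) (alpha : A -> B) (act : B -> A -> A)
    : Prop :=
  [/\ monoid_morphism alpha,
      is_group_action act,
      forall b a, alpha (act b a) = self_act b (alpha a)
    & forall a a1, act (alpha a) a1 = self_act a a1].

Record gxmod := GXMod {
  gx_top : actGroup;
  gx_base : actGroup;
  gx_bdry : gx_top -> gx_base;
  gx_act : gx_base -> gx_top -> gx_top;
  gx_modP : is_gxmod gx_bdry gx_act
}.
Arguments gx_bdry {g} _.
Arguments gx_act {g} _ _.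

Definition is_gxmod_hom (M N : gxmod)
    (f : gx_top M -> gx_top N) (g : gx_base M -> gx_base N) : Prop :=
  [/\ monoid_morphism f,
      monoid_morphism g,
      forall a, g (gx_bdry a) = gx_bdry (f a)
    & forall b a, f (gx_act b a) = gx_act (g b) (f a)].

Record category := Category {
  obj :> Type;
  hom : obj -> obj -> Type;
  idm : forall X, hom X X;
  comp : forall X Y Z, hom Y Z -> hom X Y -> hom X Z;
  comp_idl : forall X Y (f : hom X Y), comp (idm Y) f = f;
  comp_idr : forall X Y (f : hom X Y), comp f (idm X) = f;
  compA : forall W X Y Z (h : hom Y Z) (g : hom X Y) (f : hom W X),
    comp h (comp g f) = comp (comp h g) f
}.
Arguments hom {c} _ _.
Arguments idm {c} _.
Arguments comp {c X Y Z} _ _.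

Record functor (C D : category) := Functor {
  fobj :> C -> D;
  fmap : forall X Y : C, hom X Y -> hom (fobj X) (fobj Y);
  fmap_id : forall X : C, fmap (idm X) = idm (fobj X);
  fmap_comp : forall (X Y Z : C) (g : hom Y Z) (f : hom X Y),
    fmap (comp g f) = comp (fmap g) (fmap f)
}.
Arguments fmap {C D} _ {X Y} _.

Definition is_iso (C : category) (X Y : C) (f : hom X Y) : Prop :=
  exists g : hom Y X, comp g f = idm X /\ comp f g = idm Y.

Definition id_functor (C : category) : functor C C :=
  @Functor C C (fun X => X) (fun X Y f => f)
    (fun X => erefl) (fun X Y Z g f => erefl).

Lemma comp_functor_id (C D E : category) (G : functor D E) (F : functor C D)
    (X : C) : fmap G (fmap F (idm X)) = idm (G (F X)).
Proof. by rewrite !fmap_id. Qed.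

Lemma comp_functor_comp (C D E : category) (G : functor D E) (F : functor C D)
    (X Y Z : C) (g : hom Y Z) (f : hom X Y) :
  fmap G (fmap F (comp g f)) = comp (fmap G (fmap F g)) (fmap G (fmap F f)).
Proof. by rewrite !fmap_comp. Qed.

Definition comp_functor (C D E : category) (G : functor D E) (F : functor C D)
    : functor C E :=
  @Functor C E (fun X => G (F X)) (fun X Y f => fmap G (fmap F f))
    (comp_functor_id G F) (comp_functor_comp G F).

Definition naturally_isomorphic (C D : category) (F G : functor C D) : Prop :=
  exists eta : forall X : C, hom (F X) (G X),
    (forall X, is_iso (eta X)) /\
    forall (X Y : C) (f : hom X Y),
      comp (eta Y) (fmap F f) = comp (fmap G f) (eta X).

Definition equivalent_categories (C D : category) : Prop :=
  exists (F : functor C D) (G : functor D C),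
    naturally_isomorphic (comp_functor G F) (id_functor C) /\
    naturally_isomorphic (comp_functor F G) (id_functor D).

Section Coverings.
Variable M : gxmod.

Record covering := Covering {
  cov_total :> gxmod;
  cov_top : gx_top cov_total -> gx_top M;
  cov_base : gx_base cov_total -> gx_base M;
  cov_homP : is_gxmod_hom cov_top cov_base;
  cov_iso : bijective cov_top
}.

(* The components of a [gxmod] are groups with action, and a morphism of
   coverings has to respect the action of the base group on itself
   ([cm_self_act]).  This does not follow from [is_gxmod_hom], although the
   corresponding property of [cm_top] does.  Without it, already over the
   trivial generalized crossed module, the coverings would form the category of
   groups with action and arbitrary group homomorphisms, which is not
   equivalent to the category of groups with action. *)
Record cov_hom (C D : covering) := CovHom {
  cm_top : gx_top C -> gx_top D;
  cm_base : gx_base C -> gx_base D;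
  cm_homP : is_gxmod_hom cm_top cm_base;
  cm_self_act : preserves_self_act cm_base;
  cm_over_top : forall a, cov_top (cm_top a) = cov_top a;
  cm_over_base : forall b, cov_base (cm_base b) = cov_base b
}.

Lemma cov_hom_eq (C D : covering) (u v : cov_hom C D) :
  cm_top u =1 cm_top v -> cm_base u =1 cm_base v -> u = v.
Proof.
case: u v => [f g p q r s] [f' g' p' q' r' s'] /= /funext Ef /funext Eg.
by subst f' g'; congr CovHom; exact: Prop_irrelevance.
Qed.

Lemma monoid_morphism_id (G : groupType) : monoid_morphism (@id G).
Proof. by split. Qed.

Lemma monoid_morphism_comp (G H K : groupType) (g : H -> K) (f : G -> H) :
  monoid_morphism g -> monoid_morphism f -> monoid_morphism (g \o f).
Proof.
by case=> g1 gM [f1 fM]; split=> [|x y] /=; rewrite ?f1 ?fM.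
Qed.

Lemma gxmod_hom_id (N : gxmod) :
  @is_gxmod_hom N N id id.
Proof. by split=> //; exact: monoid_morphism_id. Qed.

Lemma gxmod_hom_comp (N P Q : gxmod)
    (f' : gx_top P -> gx_top Q) (g' : gx_base P -> gx_base Q)
    (f : gx_top N -> gx_top P) (g : gx_base N -> gx_base P) :
  is_gxmod_hom f' g' -> is_gxmod_hom f g ->
  is_gxmod_hom (f' \o f) (g' \o g).
Proof.
case=> f'M g'M c' a' [fM gM c a].
by split; [exact: monoid_morphism_comp | exact: monoid_morphism_comp
  | move=> x /=; rewrite c c' | move=> b x /=; rewrite a a'].
Qed.

Definition cov_id (C : covering) : cov_hom C C :=
  @CovHom C C id id (gxmod_hom_id C) (fun _ _ => erefl)
    (fun _ => erefl) (fun _ => erefl).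

Definition cov_comp (C D E : covering) (v : cov_hom D E) (u : cov_hom C D) :
  cov_hom C E.
Proof.
exists (cm_top v \o cm_top u) (cm_base v \o cm_base u).
- exact: gxmod_hom_comp (cm_homP v) (cm_homP u).
- by move=> g x /=; rewrite !cm_self_act.
- by move=> a /=; rewrite !cm_over_top.
- by move=> b /=; rewrite !cm_over_base.
Defined.

Definition Cov : category.
Proof.
exists covering cov_hom cov_id cov_comp.
- by move=> C D u; exact: cov_hom_eq.
- by move=> C D u; exact: cov_hom_eq.
- by move=> C D E F w v u; exact: cov_hom_eq.
Defined.

End Coverings.

Section Liftings.
Variable M : gxmod.

Record lifting := Lifting {
  lift_group : actGroup;
  lift_omega : lift_group -> gx_base M;
  lift_phi : gx_top M -> lift_group;
  lift_omegaP : monoid_morphism lift_omega;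
  lift_phiP : monoid_morphism lift_phi;
  lift_bdry : forall a, lift_omega (lift_phi a) = gx_bdry a;
  lift_gxmod : is_gxmod lift_phi (fun x a => gx_act (lift_omega x) a)
}.

(* A morphism of liftings commutes with the maps out of the top group
   ([lm_phi]); this is independent of [lm_omega], and it is what makes
   [id] and [lm_map] together a morphism of generalized crossed modules. *)
Record lift_hom (L K : lifting) := LiftHom {
  lm_map : lift_group L -> lift_group K;
  lm_homP : is_actGroup_hom lm_map;
  lm_omega : forall x, lift_omega (lm_map x) = lift_omega x;
  lm_phi : forall a, lm_map (lift_phi L a) = lift_phi K a
}.

Lemma lift_hom_eq (L K : lifting) (u v : lift_hom L K) :
  lm_map u =1 lm_map v -> u = v.
Proof.
case: u v => [f p q r] [f' p' q' r'] /= /funext Ef; subst f'.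
by congr LiftHom; exact: Prop_irrelevance.
Qed.

Definition lift_id (L : lifting) : lift_hom L L :=
  @LiftHom L L id (conj (monoid_morphism_id _) (fun _ _ => erefl))
    (fun _ => erefl) (fun _ => erefl).

Definition lift_comp (L K J : lifting) (v : lift_hom K J) (u : lift_hom L K) :
  lift_hom L J.
Proof.
exists (lm_map v \o lm_map u).
- case: (lm_homP v) (lm_homP u) => [vM va] [uM ua].
  by split; [exact: monoid_morphism_comp | move=> g x /=; rewrite ua va].
- by move=> x /=; rewrite !lm_omega.
- by move=> a /=; rewrite !lm_phi.
Defined.

Definition LGXM : category.
Proof.
exists lifting lift_hom lift_id lift_comp.
- by move=> L K u; exact: lift_hom_eq.
- by move=> L K u; exact: lift_hom_eq.
- by move=> L K J I w v u; exact: lift_hom_eq.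
Defined.

End Liftings.

(* Main.v *)
(** A covering <f, g> : (A~, B~, alpha~) -> (A, B, alpha) is sent to the lifting
    alpha~ f^-1 : A -> B~ over g, and a lifting phi : A -> X over omega to the
    covering <id, omega> : (A, X, phi) -> (A, B, alpha).  Up to the isomorphism
    f of the top groups, the two constructions are mutually inverse. *)

From mathcomp Require Import all_boot.
From mathcomp Require Import boolp.
Require Import Defs.

Set Implicit Arguments.
Unset Strict Implicit.
Unset Printing Implicit Defensive.

Local Open Scope group_scope.

(** The inverse enters the data of a lifting, whereas [bijective] only asserts in [Prop] that one
    exists; the choice principle [cid2] extracts it. *)
Lemma bijective_inverse (T U : Type) (f : T -> U) :
  bijective f -> {g : U -> T | cancel f g & cancel g f}.
Proof.
by move=> bij_f; apply: cid2; case: bij_f => g fK gK; exists g.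
Qed.

Lemma monoid_morphism_can (G H : groupType) (f : G -> H) (g : H -> G) :
  cancel f g -> cancel g f -> monoid_morphism f -> monoid_morphism g.
Proof.
move=> fK gK [f1 fM]; split; first by rewrite -f1 fK.
by move=> x y; apply: (can_inj fK); rewrite fM !gK.
Qed.

Lemma is_group_action_comp (G K H : groupType) (w : K -> G)
    (act : G -> H -> H) :
  monoid_morphism w -> is_group_action act ->
  is_group_action (fun k => act (w k)).
Proof.
case=> w1 wM [act1 actM act_morph]; split=> [x|g h x|g].
- by rewrite w1 act1.
- by rewrite wM actM.
- exact: act_morph.
Qed.

Section CoveringToLifting.
Variable M : gxmod.

Definition cov_inv (C : covering M) : gx_top M -> gx_top C :=
  s2val (bijective_inverse (cov_iso C)).

Lemma cov_topK (C : covering M) : cancel (@cov_top M C) (cov_inv C).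
Proof. exact: (s2valP (bijective_inverse (cov_iso C))). Qed.

Lemma cov_invK (C : covering M) : cancel (cov_inv C) (@cov_top M C).
Proof. exact: (s2valP' (bijective_inverse (cov_iso C))). Qed.

Lemma cov_inv_morphism (C : covering M) : monoid_morphism (cov_inv C).
Proof.
by case: (cov_homP C) => fM _ _ _;
  exact: monoid_morphism_can (@cov_topK C) (@cov_invK C) fM.
Qed.

(** Transports the action along the isomorphism of top groups: the action of the covering is the one
    pulled back from [M] along [cov_base], which is the action a lifting must carry. *)
Lemma cov_inv_act (C : covering M) (b : gx_base C) (a : gx_top M) :
  cov_inv C (gx_act (cov_base b) a) = gx_act b (cov_inv C a).
Proof.
case: (cov_homP C) => _ _ _ f_act.
by apply: (can_inj (@cov_topK C)); rewrite f_act !cov_invK.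
Qed.

(** Both sides lie over [a], and [cov_top] of [D] is injective. Hence the top component of a
    morphism of coverings is forced. *)
Lemma cov_hom_inv (C D : covering M) (u : cov_hom C D) (a : gx_top M) :
  cm_top u (cov_inv C a) = cov_inv D a.
Proof.
by apply: (can_inj (@cov_topK D)); rewrite cm_over_top !cov_invK.
Qed.

Definition cov_phi (C : covering M) (a : gx_top M) : gx_base C :=
  gx_bdry (cov_inv C a).

Lemma cov_base_morphism (C : covering M) : monoid_morphism (@cov_base M C).
Proof. by case: (cov_homP C). Qed.

Lemma cov_phi_morphism (C : covering M) : monoid_morphism (cov_phi C).
Proof.
by case: (gx_modP C) => bdryM _ _ _;
  exact: monoid_morphism_comp bdryM (cov_inv_morphism C).
Qed.

Lemma cov_base_phi (C : covering M) (a : gx_top M) :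
  cov_base (cov_phi C a) = gx_bdry a.
Proof. by case: (cov_homP C) => _ _ gC _; rewrite gC cov_invK. Qed.

(** Equivariance is inherited from the boundary map of [C]; the identity relating the boundary to
    the self-action comes from [M], because [cov_phi] lies over the boundary of [M]. *)
Lemma cov_phi_gxmod (C : covering M) :
  is_gxmod (cov_phi C) (fun x a => gx_act (cov_base x) a).
Proof.
case: (gx_modP M) => _ actM _ peiffer; case: (gx_modP C) => _ _ equivC _.
split.
- exact: cov_phi_morphism.
- exact: is_group_action_comp (cov_base_morphism C) actM.
- by move=> b a; rewrite /cov_phi cov_inv_act equivC.
- by move=> a a1; rewrite cov_base_phi peiffer.
Qed.

Definition lifting_of_covering (C : covering M) : lifting M :=
  Lifting (cov_base_morphism C) (cov_phi_morphism C) (@cov_base_phi C)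
    (cov_phi_gxmod C).

Definition lift_hom_of_cov_hom (C D : covering M) (u : cov_hom C D) :
  lift_hom (lifting_of_covering C) (lifting_of_covering D).
Proof.
exists (cm_base u).
- by case: (cm_homP u) => _ gM _ _; split=> //; exact: cm_self_act.
- exact: cm_over_base.
- case: (cm_homP u) => _ _ gu _ a /=.
  by rewrite /cov_phi gu cov_hom_inv.
Defined.

Definition covering_to_lifting : functor (Cov M) (LGXM M).
Proof.
exists lifting_of_covering lift_hom_of_cov_hom.
- by move=> C; exact: lift_hom_eq.
- by move=> C D E v u; exact: lift_hom_eq.
Defined.

End CoveringToLifting.

Section LiftingToCovering.
Variable M : gxmod.

Lemma lift_covering_hom (L : lifting M) :
  @is_gxmod_hom (GXMod (lift_gxmod L)) M id (@lift_omega M L).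
Proof.
by split=> //; [exact: lift_omegaP | exact: (@lift_bdry M L)].
Qed.

Definition covering_of_lifting (L : lifting M) : covering M :=
  Covering (lift_covering_hom L) (inv_bij (fun _ => erefl)).

Definition cov_hom_of_lift_hom (L K : lifting M) (u : lift_hom L K) :
  cov_hom (covering_of_lifting L) (covering_of_lifting K).
Proof.
apply: (@CovHom M (covering_of_lifting L) (covering_of_lifting K) id (lm_map u)).
- split; [exact: monoid_morphism_id | by case: (lm_homP u) | exact: (lm_phi u) |].
  (* Both actions are pulled back from [gx_base M], so equivariance of the identity amounts to
     compatibility with the maps to the base. *)
  by move=> b a /=; rewrite lm_omega.
- by case: (lm_homP u).
- by [].
- exact: lm_omega.
Defined.

Definition lifting_to_covering : functor (LGXM M) (Cov M).
Proof.
exists covering_of_lifting cov_hom_of_lift_hom.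
- by move=> L; exact: cov_hom_eq.
- by move=> L K J v u; exact: cov_hom_eq.
Defined.

End LiftingToCovering.

Section Equivalence.
Variable M : gxmod.

(** The round trip keeps the base group of [C] and replaces its top group by that of [M], so only
    the top component is not an identity. *)
Definition cov_counit (C : covering M) :
  cov_hom (covering_of_lifting (lifting_of_covering C)) C.
Proof.
apply: (@CovHom M (covering_of_lifting (lifting_of_covering C)) C
         (cov_inv C) id) => //.
- split=> //; first exact: cov_inv_morphism.
  by move=> b a; exact: cov_inv_act.
- by move=> a; exact: cov_invK.
Defined.

Definition cov_unit (C : covering M) :
  cov_hom C (covering_of_lifting (lifting_of_covering C)).
Proof.
apply: (@CovHom M C (covering_of_lifting (lifting_of_covering C))
         (@cov_top M C) id) => //.
case: (cov_homP C) => fM gM gf f_act.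
split=> // a.
by rewrite /= /cov_phi cov_topK.
Defined.

(** The covering map here is the identity, but its inverse was obtained by choice and does not
    compute; [cov_invK] shows that it is the identity pointwise. *)
Lemma lift_counit_phi (L : lifting M) (a : gx_top M) :
  cov_phi (covering_of_lifting L) a = lift_phi L a.
Proof. exact: (congr1 (lift_phi L) (@cov_invK M (covering_of_lifting L) a)). Qed.

Definition lift_counit (L : lifting M) :
  lift_hom (lifting_of_covering (covering_of_lifting L)) L :=
  @LiftHom M (lifting_of_covering (covering_of_lifting L)) L id
    (conj (monoid_morphism_id _) (fun _ _ => erefl))
    (fun _ => erefl) (lift_counit_phi L).

Definition lift_unit (L : lifting M) :
  lift_hom L (lifting_of_covering (covering_of_lifting L)) :=
  @LiftHom M L (lifting_of_covering (covering_of_lifting L)) id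
    (conj (monoid_morphism_id _) (fun _ _ => erefl))
    (fun _ => erefl) (fun a => esym (lift_counit_phi L a)).

Lemma lifting_covering_iso :
  naturally_isomorphic
    (comp_functor (lifting_to_covering M) (covering_to_lifting M))
    (id_functor (Cov M)).
Proof.
exists cov_counit; split=> [C|C D u].
  exists (cov_unit C); split; apply: cov_hom_eq => x //=.
  - exact: cov_invK.
  - exact: cov_topK.
(* The round trip of [u] is the identity on top groups, so naturality there says that [cm_top u]
   carries one chosen inverse to the other. *)
by apply: cov_hom_eq => x //=; rewrite cov_hom_inv.
Qed.

Lemma covering_lifting_iso :
  naturally_isomorphic
    (comp_functor (covering_to_lifting M) (lifting_to_covering M))
    (id_functor (LGXM M)).
Proof.
exists lift_counit; split=> [L|L K u].
  by exists (lift_unit L); split; exact: lift_hom_eq.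
exact: lift_hom_eq.
Qed.

End Equivalence.

Theorem theorem4p3 (M : gxmod) : equivalent_categories (Cov M) (LGXM M).
Proof.
exists (covering_to_lifting M), (lifting_to_covering M).
by split; [exact: lifting_covering_iso | exact: covering_lifting_iso].
Qed.
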